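(* Let $N\ge 1$, $w\in\mathbb{R}^N$, $\gamma\in\mathbb{R}$, and let $$V(z)=\sum_{1\le i\le j\le N} Q_{ij}z_iz_j+\sum_{i=1}^N d_i z_i+\mathrm{const}$$ be a quadratic polynomial with integer coefficients $Q_{ij},d_i\in\mathbb{Z}$. Let $\mathcal{C}:=\{i\in\{1,\dots,N\}: w_i\neq 0\}$ be the set of core indices, and assume $V$ is diagonal-free on the core variables, i.e. $Q_{ii}=0$ for all $i\in\mathcal{C}$. Let $\hat f(z)=w^\top z+\gamma V(z)$ for $z\in[0,1]^N$. Assume $$|\gamma|>\max_{i\in\mathcal{C}}|w_i|.$$ Then every local minimizer $z^\star$ of $\hat f$ over $[0,1]^N$ satisfies $z^\star_i\in\{0,1\}$ for all $i\in\mathcal{C}$.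
   Context: A local minimizer of $\hat f$ over $[0,1]^N$ is a point $z^\star\in[0,1]^N$ such that $\hat f(z^\star)\le\hat f(z)$ for all $z\in[0,1]^N$ in some neighborhood of $z^\star$. *)

(* Defs.v *)
From mathcomp Require Import all_boot all_order all_algebra.
From mathcomp Require Import boolp classical_sets reals topology normedtype.

Set Implicit Arguments.
Unset Strict Implicit.
Unset Printing Implicit Defensive.

Import Order.TTheory GRing.Theory Num.Theory.
Import numFieldNormedType.Exports.

Local Open Scope classical_set_scope.
Local Open Scope ring_scope.

(* Only the entries [Q i j] with [i <= j] matter; the constant term is an
   arbitrary real. *)
Definition int_quad (R : realType) (N : nat) (Q : 'M[int]_N) (d : 'cV[int]_N)
    (c : R) (z : 'cV[R]_N) : R :=
  \sum_(i < N) \sum_(j < N | (i <= j)%N) (Q i j)%:~R * z i 0 * z j 0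
  + \sum_(i < N) (d i 0)%:~R * z i 0 + c.

Definition core (R : realType) (N : nat) (w : 'cV[R]_N) : {set 'I_N} :=
  [set i | w i 0 != 0]%SET.

Definition fhat (R : realType) (N : nat) (w : 'cV[R]_N) (gamma : R)
    (V : 'cV[R]_N -> R) (z : 'cV[R]_N) : R :=
  (w^T *m z) 0 0 + gamma * V z.

Definition unit_cube (R : realType) (N : nat) : set 'cV[R]_N :=
  [set z : 'cV[R]_N | forall i, 0 <= z i 0 <= 1].

Definition local_minimizer (T : topologicalType) (R : realType)
    (f : T -> R) (D : set T) (x : T) : Prop :=
  D x /\ \forall y \near x, D y -> f x <= f y.

(* Main.v *)
(* At a local minimizer z, a direction h supported on coordinates lying strictly
   between 0 and 1 can be followed both ways, so the gradient vanishes along h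
   and the quadratic form is nonnegative at h.  If a core coordinate z_i were
   fractional, then w_i + gamma d_iV(z) = 0 with 0 < |w_i| < |gamma|, so d_iV(z)
   would not be an integer; as V has integer coefficients and Q_ii = 0, some
   other fractional z_j has a nonzero mixed coefficient with z_i.  Since
   Q_ii = 0, the quadratic form on the plane spanned by e_i and e_j is then
   indefinite, a contradiction. *)

Require Import Defs.
From mathcomp Require Import all_boot all_order all_algebra.
From mathcomp Require Import boolp classical_sets reals topology normedtype.
From mathcomp Require Import ring lra.
Import Order.TTheory GRing.Theory Num.Theory.
Import numFieldNormedType.Exports.
Local Open Scope ring_scope.

(** [A] need not be symmetric, so upper triangular coefficients fit as they are; the gradient at [z]
    is then [(A + A^T) *m z + b]. *)
Definition quad_poly {R : realType} {N : nat} (A : 'M[R]_N) (b : 'cV[R]_N)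
    (c : R) (z : 'cV[R]_N) : R :=
  (z^T *m A *m z) 0 0 + (b^T *m z) 0 0 + c.

Lemma addmxE (R : nmodType) (m n : nat) (u v : 'M[R]_(m, n)) i j :
  (u + v) i j = u i j + v i j.
Proof. exact: mxE. Qed.

Lemma scalemxE (R : pzRingType) (m n : nat) (a : R) (u : 'M[R]_(m, n)) i j :
  (a *: u) i j = a * u i j.
Proof. exact: mxE. Qed.

Lemma quad_poly_line (R : realType) (N : nat) (A : 'M[R]_N) (b : 'cV[R]_N)
    (c : R) (z h : 'cV[R]_N) (t : R) :
  quad_poly A b c (z + t *: h) =
  quad_poly A b c z + t * (((A + A^T) *m z + b)^T *m h) 0 0
  + t ^+ 2 * (h^T *m A *m h) 0 0.
Proof.
have hz : (h^T *m A *m z) 0 0 = (z^T *m A^T *m h) 0 0.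
  by rewrite -[in RHS](trmxK h) -trmx_mul -mulmxA -trmx_mul [RHS]mxE.
rewrite /quad_poly.
have -> : (z + t *: h)^T = z^T + t *: h^T by rewrite !linearE.
have -> : ((A + A^T) *m z + b)^T = z^T *m A + z^T *m A^T + b^T.
  by rewrite linearD /= trmx_mul linearD /= trmxK mulmxDr [X in X + _]addrC.
rewrite !(mulmxDl, mulmxDr) -!(scalemxAl, scalemxAr) !(addmxE, scalemxE) hz.
ring.
Qed.

Lemma quad_nonneg_near0 {R : realType} (L M : R) :
  (\forall t \near (0 : R), 0 <= t * L + t ^+ 2 * M) -> L = 0 /\ 0 <= M.
Proof.
move=> H.
have {H} [e e0 He] : exists2 e : R, 0 < e &
    forall t, `|t| < e -> 0 <= t * L + t ^+ 2 * M.
  move: H => /nbhs_ballP [e /= e0 He]; exists e => // t te.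
  by apply: He; rewrite /ball /= sub0r normrN.
(* Averaging [t] and [- t] isolates the quadratic term. *)
have Mge0 : 0 <= M.
  have te : `|e / 2| < e by rewrite gtr0_norm; lra.
  have := He _ te; have := He (- (e / 2)); rewrite normrN => /(_ te) h1 h2.
  have : 0 < e ^+ 2 by rewrite exprn_gt0.
  nra.
split=> //; apply/eqP/negP => /negP L0.
(* Of [s] and [- s], take the one whose sign makes the linear term negative. *)
have key s : 0 <= s -> s < e -> s * `|L| <= s ^+ 2 * M.
  move=> s0 se; have := He s; have := He (- s).
  rewrite normrN ger0_norm // sqrrN mulNr => /(_ se) h1 /(_ se) h2.
  by have [_|_] := ger0P L; lra.
(* Small enough that [s * M] is below the absolute value of [L], against [key]; [M + 1] keeps the
   denominator positive when [M = 0]. *)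
pose s := Num.min (e / 2) (`|L| / (2 * (M + 1))).
have aL : 0 < `|L| by rewrite normr_gt0.
have M1 : 0 < 2 * (M + 1) by lra.
have s0 : 0 < s by rewrite lt_min !divr_gt0.
have se : s < e by rewrite gt_min; apply/orP; left; lra.
have : s * (2 * (M + 1)) <= `|L| by rewrite -ler_pdivlMr // ge_min lexx orbT.
have := key s (ltW s0) se; nra.
Qed.

Lemma line_cvg {R : realType} {N : nat} (z h : 'cV[R]_N) :
  ((fun t : R => z + t *: h) @ (0 : R) --> z)%classic.
Proof.
have : ((fun t : R => z + t *: h) @ (0 : R) --> z + 0 *: h)%classic.
  by apply: cvgD; [exact: cvg_cst | apply: cvgZr_tmp; exact: cvg_id].
by rewrite scale0r addr0.
Qed.

(** Coordinates outside the support of [h] do not move, the others start in the open interval, and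
    finitely many neighborhoods of 0 intersect in a neighborhood. *)
Lemma near_line_unit_cube {R : realType} {N : nat} {z h : 'cV[R]_N} :
  unit_cube z -> (forall i, h i 0 != 0 -> 0 < z i 0 < 1) ->
  \forall t \near (0 : R), unit_cube (z + t *: h).
Proof.
move=> zD hz.
have := @filter_forall R 'I_N (fun i t => 0 <= (z + t *: h) i 0 <= 1)
  (nbhs (0 : R)) _.
apply => i.
have [hi0|hi0] := eqVneq (h i 0) 0.
  by near=> t; rewrite !mxE hi0 mulr0 addr0.
have /andP[z0 z1] := hz _ hi0.
have c : ((fun t : R => z i 0 + t * h i 0) @ (0 : R) --> z i 0)%classic.
  have : ((fun t : R => z i 0 + t * h i 0) @ (0 : R) -->
      z i 0 + 0 * h i 0)%classic.
    by apply: cvgD; [exact: cvg_cst | apply: cvgMr_tmp; exact: cvg_id].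
  by rewrite mul0r addr0.
near=> t; rewrite !mxE; apply/andP; split; apply/ltW; near: t.
  exact: (cvgr_gt _ c).
exact: (cvgr_lt _ c).
Unshelve. all: by end_near.
Qed.

Lemma quad_poly_local_minimizer {R : realType} {N : nat} {A : 'M[R]_N}
    {b : 'cV[R]_N} {c : R} {z h : 'cV[R]_N} :
  local_minimizer (quad_poly A b c) (@unit_cube R N) z ->
  (forall i, h i 0 != 0 -> 0 < z i 0 < 1) ->
  (((A + A^T) *m z + b)^T *m h) 0 0 = 0 /\ 0 <= (h^T *m A *m h) 0 0.
Proof.
move=> [zD zmin] hz; apply: quad_nonneg_near0.
have cube := near_line_unit_cube zD hz.
have lmin : \forall t \near (0 : R), unit_cube (z + t *: h) ->
    quad_poly A b c z <= quad_poly A b c (z + t *: h) := line_cvg z h _ zmin.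
near=> t.
have zt : unit_cube (z + t *: h) by near: t.
have : quad_poly A b c z <= quad_poly A b c (z + t *: h).
  by move: zt; near: t.
by rewrite quad_poly_line; lra.
Unshelve. all: by end_near.
Qed.

(** Keeping [gamma] as an outer factor leaves matrices with integer entries, on which the
    integrality argument relies. *)
Lemma fhat_int_quadE {R : realType} {N : nat} (w : 'cV[R]_N) (gamma : R)
    (Q : 'M[int]_N) (d : 'cV[int]_N) (c : R) :
  fhat w gamma (int_quad Q d c) =
  quad_poly (gamma *: \matrix_(i, j) (if (i <= j)%N then (Q i j)%:~R else 0))
    (w + gamma *: map_mx intr d) (gamma * c).
Proof.
apply/funext => z; rewrite /fhat /int_quad /quad_poly.
set A := \matrix_(i, j) _.
have -> : \sum_(i < N) \sum_(j < N | (i <= j)%N) (Q i j)%:~R * z i 0 * z j 0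
    = (z^T *m A *m z) 0 0.
  rewrite -mulmxA mxE; apply: eq_bigr => i _.
  rewrite !mxE mulr_sumr big_mkcond; apply: eq_bigr => j _; rewrite !mxE.
  by case: leqP => _; ring.
have -> : \sum_(i < N) (d i 0)%:~R * z i 0 = ((map_mx intr d)^T *m z) 0 0.
  by rewrite mxE; apply: eq_bigr => i _; rewrite !mxE.
rewrite !linearE /= !mulmxDl -!(scalemxAl, scalemxAr).
by rewrite !(addmxE, scalemxE); ring.
Qed.

(* The values [`|w i 0|] are nonnegative, so the neutral element 0 of the
   iterated maximum does not change it unless [core w] is empty, in which case
   the conclusion is vacuous. *)
Theorem theorem2p5 (R : realType) (N : nat) (w : 'cV[R]_N) (gamma : R)
    (Q : 'M[int]_N) (d : 'cV[int]_N) (c : R) :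
  (1 <= N)%N ->
  (forall i, i \in core w -> Q i i = 0) ->
  \big[Num.max/0]_(i in core w) `|w i 0| < `|gamma| ->
  forall zs : 'cV[R]_N,
    local_minimizer (fhat w gamma (int_quad Q d c)) (@unit_cube R N) zs ->
    forall i, i \in core w -> zs i 0 = 0 \/ zs i 0 = 1.
Proof.
move=> _ Qdiag wlt z zmin i iC.
have zcube j : 0 <= z j 0 <= 1 := zmin.1 j.
have wi : w i 0 != 0 by move: iC; rewrite inE.
have wi_lt : `|w i 0| < `|gamma|.
  by apply: le_lt_trans wlt; exact: (le_bigmax_cond _ (fun i => `|w i 0|) iC).
have g0 : gamma != 0 by rewrite -normr_gt0; apply: le_lt_trans wi_lt.
have bin_or_frac j : (z j 0 == 0) || (z j 0 == 1) || (0 < z j 0 < 1).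
  have /andP[] := zcube j; rewrite !le_eqVlt [0 == _]eq_sym.
  by case: (z j 0 == 0) => //=; case: (z j 0 == 1) => //= -> ->.
set A := \matrix_(i, j) (if (i <= j)%N then (Q i j)%:~R else 0 : R) : 'M[R]_N.
have Aint k l : A k l \is a Num.int.
  by rewrite mxE; case: ifP => _; [exact: intr_int | exact: rpred0].
have Aii : A i i = 0 by rewrite mxE leqnn Qdiag.
move: zmin; rewrite fhat_int_quadE -/A => zmin.
case/orP: (bin_or_frac i) => [/orP[] /eqP ->|zi]; [by left | by right | exfalso].
have grad_i : w i 0 + gamma * (\sum_j (A i j + A j i) * z j 0 + (d i 0)%:~R) = 0.
  have [|gi _] := quad_poly_local_minimizer zmin (h := delta_mx i 0).
    by move=> k; rewrite !mxE andbT; case: (eqVneq k i) => [->//|_]; rewrite eqxx.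
  rewrite -[RHS]gi -colE !mxE mulrDr mulr_sumr addrCA; congr (_ + _).
  by apply: eq_bigr => j _; rewrite !(addmxE, scalemxE, mxE); ring.
(* Otherwise each term of the sum in [grad_i] is an integer, so [w i 0] is a nonzero integer
   multiple of [gamma], too large for [wi_lt]. Such a [j] differs from [i] because of [Aii]. *)
have [j Sij zj] : exists2 j, A i j + A j i != 0 & 0 < z j 0 < 1.
  apply: contrapT => noj.
  set k : R := \sum_j _ + _ in grad_i.
  have kint : k \is a Num.int.
    apply: rpredD; last exact: intr_int.
    apply: rpred_sum => j _.
    case/orP: (bin_or_frac j) => [/orP[] /eqP ->|zj].
    - by rewrite mulr0 rpred0.
    - by rewrite mulr1 rpredD.
    - have [->|Sij] := eqVneq (A i j + A j i) 0; first by rewrite mul0r rpred0.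
      by case: noj; exists j.
  have wE : w i 0 = - (gamma * k) by apply/eqP; rewrite -addr_eq0 grad_i.
  have k0 : k != 0 by apply: contra_neq wi => k0; rewrite wE k0 mulr0 oppr0.
  move: wi_lt; rewrite wE normrN normrM ltNge => /negP; apply.
  by rewrite ler_peMr // norm_intr_ge1.
(* [a] makes the quadratic form of [gamma V] at [a e_i + e_j] equal [- gamma ^+ 2]. *)
pose a := (- gamma - A j j) / (A i j + A j i).
have [k|_] := quad_poly_local_minimizer zmin
    (h := a *: delta_mx i 0 + delta_mx j 0).
  rewrite !mxE !andbT; case: (eqVneq k i) => [->//|_].
  by case: (eqVneq k j) => [->//|_]; rewrite mulr0 addr0 eqxx.
have E k l : ((delta_mx 0 k : 'rV_N) *m A *m (delta_mx l 0 : 'cV_N)) 0 0 = A k l.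
  by rewrite -rowE -colE !mxE.
have -> : (a *: delta_mx i 0 + delta_mx j 0 : 'cV[R]_N)^T
    = a *: delta_mx 0 i + delta_mx 0 j by rewrite linearD linearZ /= !trmx_delta.
have aS : a * (A i j + A j i) = - gamma - A j j by rewrite mulfVK.
(* [Aii] removes the [a ^+ 2] term: the form is affine in [a] with nonzero slope, hence takes every
   value. *)
rewrite !(mulmxDl, mulmxDr) -!(scalemxAl, scalemxAr) !(addmxE, scalemxE, E) Aii.
have g2 : 0 < gamma ^+ 2 by rewrite exprn_even_gt0.
have : gamma * (a * (A i j + A j i) + A j j) = - gamma ^+ 2 by rewrite aS; ring.
nra.
Qed.
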